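(* Let $(X,\tau,\mathcal{I},\mathfrak{a})$ be an ideal-aura topological space with $\mathfrak{a}$ transitive. For $A\subseteq X$ the following are equivalent: (i) $A\in\tau^{*}_{\mathfrak{a}}$; (ii) $A\subseteq\psi_{\mathfrak{a}}(A)$.
   Context: An ideal on a set $X$ is a non-empty collection $\mathcal{I}\subseteq\mathcal{P}(X)$ closed under taking subsets and finite unions. A scope function on a topological space $(X,\tau)$ is a function $\mathfrak{a}:X\to\tau$ with $x\in\mathfrak{a}(x)$ for every $x\in X$; it is transitive if $y\in\mathfrak{a}(x)$ implies $\mathfrak{a}(y)\subseteq\mathfrak{a}(x)$ for all $x,y\in X$. An ideal-aura topological space $(X,\tau,\mathcal{I},\mathfrak{a})$ is a topological space $(X,\tau)$ with an ideal $\mathcal{I}$ on $X$ and a scope function $\mathfrak{a}:X\to\tau$. For $A\subseteq X$: $A^{\mathfrak{a}}(\mathcal{I})=\{x\in X:\mathfrak{a}(x)\cap A\notin\mathcal{I}\}$; $\operatorname{cl}^{*}_{\mathfrak{a}}(A)=A\cup A^{\mathfrak{a}}(\mathcal{I})$; $\operatorname{cl}^{*0}_{\mathfrak{a}}(A)=A$, $\operatorname{cl}^{*(n+1)}_{\mathfrak{a}}(A)=\operatorname{cl}^{*}_{\mathfrak{a}}(\operatorname{cl}^{*n}_{\mathfrak{a}}(A))$, and $\operatorname{cl}^{*\infty}_{\mathfrak{a}}(A)=\bigcup_{n=0}^{\infty}\operatorname{cl}^{*n}_{\mathfrak{a}}(A)$. $\tau^{*}_{\mathfrak{a}}=\{A\subseteq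 X:\operatorname{cl}^{*\infty}_{\mathfrak{a}}(X\setminus A)=X\setminus A\}$, and $\psi_{\mathfrak{a}}(A)=\{x\in X:\mathfrak{a}(x)\setminus A\in\mathcal{I}\}=X\setminus (X\setminus A)^{\mathfrak{a}}(\mathcal{I})$. *)

(* Defs.v *)
From mathcomp Require Import all_boot.
From mathcomp Require Import boolp classical_sets topology.

Set Implicit Arguments.
Unset Strict Implicit.
Unset Printing Implicit Defensive.

Local Open Scope classical_set_scope.

(* Binary unions suffice: with the other two conditions they give all finite
   unions, the empty one included. *)
Definition is_ideal (X : Type) (I : set (set X)) : Prop :=
  [/\ I !=set0,
      (forall A B : set X, B `<=` A -> I A -> I B) &
      (forall A B : set X, I A -> I B -> I (A `|` B))].

Definition is_scope (X : topologicalType) (a : X -> set X) : Prop :=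
  forall x, open (a x) /\ a x x.

Definition transitive_scope (X : topologicalType) (a : X -> set X) : Prop :=
  forall x y, a x y -> a y `<=` a x.

Section IdealAura.
Variables (X : topologicalType) (I : set (set X)) (a : X -> set X).

Definition aura_local (A : set X) : set X := [set x | ~ I (a x `&` A)].

Definition aura_cl (A : set X) : set X := A `|` aura_local A.

Definition aura_cl_iter (n : nat) (A : set X) : set X := iter n aura_cl A.

Definition aura_cl_infty (A : set X) : set X :=
  \bigcup_(n in [set: nat]) aura_cl_iter n A.

Definition aura_tau : set (set X) :=
  [set A | aura_cl_infty (~` A) = ~` A].

Definition aura_psi (A : set X) : set X := [set x | I (a x `\` A)].

Lemma aura_psiE (A : set X) : aura_psi A = ~` aura_local (~` A).
Proof.
by apply/seteqP; split=> x; rewrite /aura_psi /aura_local /= -setDE not_notE.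
Qed.

End IdealAura.

(* Main.v *)
(** The set [B] equals [aura_cl_infty B] exactly when [aura_cl B = B], i.e. when
    [aura_local B `<=` B]: the first iterate lies in the union, and a fixed
    point is fixed by all iterates. With [B := ~` A], taking complements
    gives [A `<=` aura_psi A]. *)
Require Import Defs.
From mathcomp Require Import all_boot.
From mathcomp Require Import boolp classical_sets topology.

Local Open Scope classical_set_scope.

Lemma aura_cl_infty_id (X : topologicalType) (I : set (set X))
    (a : X -> set X) (B : set X) :
  aura_cl_infty I a B = B <-> aura_local I a B `<=` B.
Proof.
(* The witness is [1] because [aura_local] first enters at iterate one, as the right half of the
   union. *)
split=> [clB x Bx|localB]; first by rewrite -clB; exists 1 => //; right.
have iterB n : aura_cl_iter I a n B = B.
  (* [IHn] matches the inner [iter] by conversion; what remains is [aura_cl I a B = B], a union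
     absorbed by [localB]. *)
  by elim: n => // n IHn; rewrite /aura_cl_iter iterS [iter _ _ _]IHn; apply/setUidPl.
apply/seteqP; split=> [x [n _]|x Bx]; first by rewrite iterB.
by exists 0.
Qed.

Theorem theorem5p3 (X : topologicalType) (I : set (set X)) (a : X -> set X)
  (hI : is_ideal I) (ha : is_scope a) (hT : transitive_scope a) (A : set X) :
  aura_tau I a A <-> A `<=` aura_psi I a A.
Proof.
(* [aura_tau] unfolds to the fixed-point equation for the complement of [A], leaving two
   contrapositive inclusions. *)
rewrite aura_psiE; apply: iff_trans (aura_cl_infty_id _ _ _ _) _.
by split=> /subsetC; rewrite setCK.
Qed.
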